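(* Let $P,Q$ be two (Borel) probability measures on the same metric space $(\mathcal{X},d)$. Suppose that for some $h>0$ there is a $\lambda>0$ such that $$P(\mathsf{B}(x,h))\ge\lambda\,Q(\mathsf{B}(x,h))\qquad\text{for all }x\in\mathcal{X}.$$ Then $$\rho_h(P,Q)\le\frac{N(h/2)}{\lambda}.$$
   Context: $\mathsf{B}(x,h)=\{x'\in\mathcal{X}:d(x,x')\le h\}$ is the closed ball. The similarity measure is $\rho_h(P,Q)=\int_{\mathcal{X}}\frac{1}{P(\mathsf{B}(x,h))}\,dQ(x)$ (with $1/0=+\infty$). For $r>0$, the covering number $N(r)$ is the smallest number of closed balls of radius $r$ (with centers in $\mathcal{X}$) needed to cover $\mathcal{X}$ ($N(r)=+\infty$ if no finite cover exists). *)

(* Defs.v *)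
From HB Require Import structures.
From mathcomp Require Import all_boot all_order all_algebra.
From mathcomp Require Import all_classical all_reals all_analysis.

Set Implicit Arguments.
Unset Strict Implicit.
Unset Printing Implicit Defensive.

Import Order.TTheory GRing.Theory Num.Theory.
Local Open Scope classical_set_scope.
Local Open Scope ring_scope.

(* Measurable types of the library are pointed. Asking for a point loses no
   generality here: a space carrying a probability measure is nonempty. *)
#[short(type="pointedMetricType")]
HB.structure Definition PointedMetric (K : numDomainType) :=
  { M of Pointed M & Metric K M }.

Notation borelType X := (g_sigma_algebraType (@open X)) (only parsing).

(* Not the library's closed_ball, which is the closure of the open ball and can
   be strictly smaller than { y | d(x, y) <= r } in a general metric space. *)
Definition cball (R : realType) (X : pointedMetricType R) (x : X) (r : R) :
  set X := [set y | mdist x y <= r].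

(* The integrand is Borel and takes the value +oo where P (cball x h) = 0,
   since 0^-1 = +oo in \bar R. *)
Definition similarity (R : realType) (X : pointedMetricType R) (h : R)
    (P Q : probability (borelType X) R) : \bar R :=
  (\int[Q]_(x in [set: borelType X]) (P (cball (x : X) h))^-1)%E.

(* The infimum of the empty set is +oo, and that of a nonempty set of natural
   numbers is its minimum. *)
Definition covering_number (R : realType) (X : pointedMetricType R) (r : R) :
  \bar R :=
  ereal_inf [set (n%:R)%:E | n in [set n : nat |
    exists c : 'I_n -> X,
      [set: X] `<=` \bigcup_(i in [set: 'I_n]) cball (c i) r]].

(* Main.v *)
Require Import Defs.
From mathcomp Require Import all_boot all_order all_algebra.
From mathcomp Require Import all_classical all_reals all_analysis measurable_realfun.

Set Implicit Arguments.
Unset Strict Implicit.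
Unset Printing Implicit Defensive.

Import Order.TTheory GRing.Theory Num.Theory.
Local Open Scope classical_set_scope.
Local Open Scope ring_scope.

(* Cover the space by n balls B_i of radius h/2. If x lies in B_i then B_i is
   contained in the ball B(x,h), so P(B(x,h)) >= lambda Q(B(x,h)) >= lambda Q(B_i).
   Hence the integrand is at most the sum over i of the indicator function of
   B_i divided by lambda Q(B_i), and each of the n terms has Q-integral at most
   1/lambda. *)

(** The complement is open: if d(x,y) > r, the open ball of radius d(x,y) - r around y misses
    [cball x r], by the triangle inequality. *)
Lemma cball_measurable (R : realType) (X : pointedMetricType R) (x : X) (r : R) :
  measurable (cball x r : set (borelType X)).
Proof.
rewrite -[cball x r]setCK; apply: measurableC; apply: sub_gen_smallest => /=.
rewrite openE => y /= /negP; rewrite -ltNge => rxy.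
apply/metricType_numDomainType.nbhs_mdistP.
exists (mdist x y - r) => /=; first by rewrite subr_gt0.
move=> z /= yz zr; have := metric_triangle x z y.
rewrite leNgt => /negP; apply; rewrite (metric_sym z).
by rewrite -(subrKC r (mdist x y)) ler_ltD.
Qed.

Lemma cball_half_subset (R : realType) (X : pointedMetricType R) (c x : X)
    (h : R) : cball c (h / 2) x -> cball c (h / 2) `<=` cball x h.
Proof.
move=> cx y cy; apply: le_trans (metric_triangle x c y) _.
by rewrite (metric_sym x) [leRHS]splitr lerD.
Qed.

(* The library's ge0_le_integral asks for measurable functions. The integral of
   a nonnegative function is a supremum over simple functions below it, so it is
   monotone without that hypothesis. *)
Lemma ge0_le_integralT (d : measure_display) (T : measurableType d)
    (R : realType) (mu : {measure set T -> \bar R}) (f g : T -> \bar R) :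
  (forall x, 0 <= f x)%E -> (forall x, f x <= g x)%E ->
  (\int[mu]_x f x <= \int[mu]_x g x)%E.
Proof.
move=> f0 fg.
rewrite !ge0_integralTE//; last by move=> x; exact: le_trans (fg x).
apply: ereal_sup_le => _ [k kf <-]; exists k => //= x.
exact: le_trans (fg x).
Qed.

Lemma integral_inv_measure_le (d : measure_display) (T : measurableType d)
    (R : realType) (Q : probability T R) (B : set T) (lambda : R) :
  measurable B -> 0 < lambda ->
  (\int[Q]_x ((lambda%:E * Q B)^-1 * (\1_B x)%:E) <= (lambda^-1)%:E)%E.
Proof.
move=> mB l0; rewrite ge0_integralZl//; last 2 first.
- exact/measurable_EFinP.
- by rewrite inve_ge0 mule_ge0// lee_fin ltW.
have -> : (\int[Q]_x (\1_B x)%:E = Q B)%E by rewrite integral_indic// setIT.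
(* If [Q B] is 0, the coefficient is +oo, but +oo * 0 = 0; otherwise [Q B] cancels and the value is
   exactly 1/lambda. *)
have [->|QB0] := eqVneq (Q B) 0%E.
  by rewrite !mule0 lee_fin invr_ge0 ltW.
have QBfin : Q B \is a fin_num by exact: fin_num_measure.
move: QB0 QBfin; case: (Q B) => // q; rewrite eqe => q0 _.
rewrite -EFinM inver mulf_eq0 (gt_eqF l0) (negPf q0) /= -EFinM lee_fin.
by rewrite invfM mulfVK.
Qed.

Lemma similarity_le_card_cover (R : realType) (X : pointedMetricType R)
    (P Q : probability (borelType X) R) (h lambda : R) (n : nat)
    (c : 'I_n -> X) :
  0 < lambda ->
  (forall x : X, (lambda%:E * Q (cball x h) <= P (cball x h))%E) ->
  [set: X] `<=` \bigcup_(i in [set: 'I_n]) cball (c i) (h / 2) ->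
  (similarity h P Q <= (n%:R / lambda)%:E)%E.
Proof.
move=> l0 PQ cover; rewrite /similarity.
pose B i : set (borelType X) := cball (c i) (h / 2).
have mB i : measurable (B i) by exact: cball_measurable.
pose g i (x : borelType X) : \bar R :=
  ((lambda%:E * Q (B i))^-1 * (\1_(B i) x)%:E)%E.
have lQ0 (A : set (borelType X)) : (0 <= lambda%:E * Q A)%E.
  by rewrite mule_ge0// lee_fin ltW.
have g0 i x : (0 <= g i x)%E by rewrite mule_ge0 ?inve_ge0 ?lee_fin.
have mg i : measurable_fun setT (g i).
  by apply: measurable_funeM; exact/measurable_EFinP.
apply: (@le_trans _ _ (\int[Q]_x \sum_(i < n) g i x)%E).
  apply: ge0_le_integralT => [x|x]; first by rewrite inve_ge0.
  have [i _ Bx] := cover (x : X) I.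
  (* Keep the term of one ball containing [x]; the others are nonnegative. *)
  rewrite (bigD1 i)//=; apply: le_trans (leeDl _ _); last exact: sume_ge0.
  (* Inversion reverses the order on all of [0, +oo], so balls of measure zero fit in without a case
     split. *)
  rewrite /g indicE mem_set// mule1 lee_pV2 ?inE//.
  apply: le_trans (PQ x); rewrite lee_pmul2l ?lte_fin//.
  apply: le_measure; rewrite ?inE//; first exact: cball_measurable.
  exact: cball_half_subset.
rewrite ge0_integral_sum//.
apply: (@le_trans _ _ (\sum_(i < n) (lambda^-1)%:E)%E).
  by apply: lee_sum => i _; exact: integral_inv_measure_le.
by rewrite sumEFin sumr_const card_ord mulr_natl.
Qed.

Theorem proposition1 (R : realType) (X : pointedMetricType R)
    (P Q : probability (borelType X) R) (h : R) (h_gt0 : 0 < h)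
    (lambda : R) (lambda_gt0 : 0 < lambda)
    (PQ : forall x : X, (lambda%:E * Q (cball x h) <= P (cball x h))%E) :
  (similarity h P Q <= covering_number X (h / 2) / lambda%:E)%E.
Proof.
(* Moving [lambda] to the left isolates the infimum, so it suffices to treat each finite cover; if
   there is none, the infimum is +oo. *)
rewrite inver gt_eqF// lee_pdivlMr//.
apply: le_ereal_inf_tmp => _ [n [c cover] <-].
by rewrite -lee_pdivlMr// -EFinM; exact: similarity_le_card_cover cover.
Qed.
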